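(* Consider the linear program (P) and its Lagrangian relaxation with respect to the duplication constraints, as given in the context. Let $(\mu_k)_{k\ge1}$ be a sequence with $\mu_k\ge0$, $\lim_{k\to\infty}\mu_k=0$, $\sum_{k=1}^\infty\mu_k=\infty$ and $\sum_{k=1}^\infty\mu_k^2<\infty$. Consider the iterative process, started from arbitrary initial multipliers, where at each iteration $k$ the values $x_{co,g}^{g\to e\,(k)},x_{co,e}^{g\to e\,(k)},x_{co,g}^{g\to h\,(k)},x_{co,h}^{g\to h\,(k)}$ are obtained by solving the gas, electricity and heat subproblems with multipliers $\sigma_{co}^{g\to e\,(k)},\sigma_{co}^{g\to h\,(k)}$, and the multipliers are updated by $$\sigma_{co}^{g\to e\,(k+1)}=\sigma_{co}^{g\to e\,(k)}-\mu_k\big(x_{co,g}^{g\to e\,(k)}-x_{co,e}^{g\to e\,(k)}\big),\qquad \sigma_{co}^{g\to h\,(k+1)}=\sigma_{co}^{g\to h\,(k)}-\mu_k\big(x_{co,g}^{g\to h\,(k)}-x_{co,h}^{g\to h\,(k)}\big).$$ Then $\sigma_{co}^{g\to e\,(k)}\to\sigma_{co}^{g\to e\,*}$ and $\sigma_{co}^{g\to h\,(k)}\to\sigma_{co}^{g\to h\,*}$ as $k\to\infty$, where $(\sigma^{g\to e\,*},\sigma^{g\to h\,*})$ is an optimal solution of the Lagrangian dual problem $\min_{\sigma^{g\to e},\sigma^{g\to h}}\phi(\sigma^{g\to e},\sigma^{g\to h})$.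
   Context: Carriers are gas ($g$), electricity ($e$), heat ($h$). $\mathcal O^c$ is a finite set of elementary orders of carrier $c$, with limit price $P_o^c$, quantity $Q_o^c$ ($<0$ for sell, $>0$ for buy) and acceptance ratio $x_o^c$. $\mathcal O^{g\to e},\mathcal O^{g\to h}$ are finite sets of conversion orders with conversion price $P_{co}$, capacity $Q_{co}>0$, efficiency $\eta_{co}>0$ (with the corresponding superscript). The acceptance variable of each conversion order is duplicated: $x_{co,g}^{g\to e},x_{co,g}^{g\to h}$ in the gas market, $x_{co,e}^{g\to e}$ in the electricity market, $x_{co,h}^{g\to h}$ in the heat market. Put $Q_{co,g}^{g\to e}=Q_{co}^{g\to e}$, $Q_{co,g}^{g\to h}=Q_{co}^{g\to h}$, $Q_{co,e}^{g\to e}=\eta_{co}^{g\to e}Q_{co}^{g\to e}$, $Q_{co,h}^{g\to h}=\eta_{co}^{g\to h}Q_{co}^{g\to h}$. Problem (P): maximise $$\Omega(x)=\sum_{c\in\{g,e,h\}}\sum_{o\in\mathcal O^c}P_o^cQ_o^cx_o^c-\sum_{co\in\mathcal O^{g\to e}}P_{co}^{g\to e}Q_{co}^{g\to e}x_{co,e}^{g\to e}-\sum_{co\in\mathcal O^{g\to h}}P_{co}^{g\to h}Q_{co}^{g\to h}x_{co,h}^{g\to h}$$ subject to the duplication constraints $x_{co,g}^{g\to e}=x_{co,e}^{g\to e}$ ($co\in\mathcal O^{g\to e}$) and $x_{co,g}^{g\to h}=x_{co,h}^{g\to h}$ ($co\in\mathcal O^{g\to h}$), the gas balance (G) $\sum_{o\in\mathcal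 O^g}Q_o^gx_o^g=-\sum_{co\in\mathcal O^{g\to e}}Q_{co,g}^{g\to e}x_{co,g}^{g\to e}-\sum_{co\in\mathcal O^{g\to h}}Q_{co,g}^{g\to h}x_{co,g}^{g\to h}$, the electricity balance (E) $\sum_{o\in\mathcal O^e}Q_o^ex_o^e=\sum_{co\in\mathcal O^{g\to e}}Q_{co,e}^{g\to e}x_{co,e}^{g\to e}$, the heat balance (H) $\sum_{o\in\mathcal O^h}Q_o^hx_o^h=\sum_{co\in\mathcal O^{g\to h}}Q_{co,h}^{g\to h}x_{co,h}^{g\to h}$, and all variables in $[0,1]$. Lagrangian relaxation: $\phi(\sigma^{g\to e},\sigma^{g\to h})=\max_x\{\Omega(x)+\sum_{co\in\mathcal O^{g\to e}}\sigma_{co}^{g\to e}(x_{co,g}^{g\to e}-x_{co,e}^{g\to e})+\sum_{co\in\mathcal O^{g\to h}}\sigma_{co}^{g\to h}(x_{co,g}^{g\to h}-x_{co,h}^{g\to h})\}$, the maximum being over $x$ with all components in $[0,1]$ satisfying (G), (E), (H). For fixed multipliers it splits into the subproblems (all variables in $[0,1]$): Gas: maximise $\sum_{o\in\mathcal O^g}P_o^gQ_o^gx_o^g+\sum_{co}\sigma_{co}^{g\to e}x_{co,g}^{g\to e}+\sum_{co}\sigma_{co}^{g\to h}x_{co,g}^{g\to h}$ subject to (G). Electricity: maximise $\sum_{o\in\mathcal O^e}P_o^eQ_o^ex_o^e-\sum_{co}P_{co}^{g\to e}Q_{co}^{g\to e}x_{co,e}^{g\to e}-\sum_{co}\sigma_{co}^{g\to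 e}x_{co,e}^{g\to e}$ subject to (E). Heat: maximise $\sum_{o\in\mathcal O^h}P_o^hQ_o^hx_o^h-\sum_{co}P_{co}^{g\to h}Q_{co}^{g\to h}x_{co,h}^{g\to h}-\sum_{co}\sigma_{co}^{g\to h}x_{co,h}^{g\to h}$ subject to (H). At each iteration any optimal solution of each subproblem may be chosen. *)

(* Defs.v *)
From HB Require Import structures.
From mathcomp Require Import all_boot all_order all_algebra.
From mathcomp Require Import all_classical all_reals all_analysis.

Set Implicit Arguments.
Unset Strict Implicit.
Unset Printing Implicit Defensive.

Import Order.TTheory GRing.Theory Num.Theory.
Import numFieldNormedType.Exports.

Local Open Scope classical_set_scope.
Local Open Scope ring_scope.

(* [quantity] is negative for a sell order and positive for a buy order. *)
Record orders (R : realType) := Orders {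
  order :> finType;
  price : order -> R;
  quantity : order -> R;
  quantity_neq0 : forall o, quantity o != 0 }.

(* [capacity] is measured in the input carrier, gas. *)
Record conversions (R : realType) := Conversions {
  conversion :> finType;
  conv_price : conversion -> R;
  capacity : conversion -> R;
  efficiency : conversion -> R;
  capacity_gt0 : forall co, 0 < capacity co;
  efficiency_gt0 : forall co, 0 < efficiency co }.

Definition output_capacity (R : realType) (C : conversions R) (co : C) : R :=
  efficiency co * capacity co.

Record market (R : realType) := Market {
  gas_orders : orders R;
  elec_orders : orders R;
  heat_orders : orders R;
  g2e : conversions R;
  g2h : conversions R }.

Record gas_var (R : realType) (M : market R) := GasVar {
  gas_x : gas_orders M -> R;
  gas_g2e : g2e M -> R;
  gas_g2h : g2h M -> R }.

Record elec_var (R : realType) (M : market R) := ElecVar {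
  elec_x : elec_orders M -> R;
  elec_g2e : g2e M -> R }.

Record heat_var (R : realType) (M : market R) := HeatVar {
  heat_x : heat_orders M -> R;
  heat_g2h : g2h M -> R }.

Record var (R : realType) (M : market R) := Var {
  gas_part : gas_var M;
  elec_part : elec_var M;
  heat_part : heat_var M }.

Definition unit_box (R : realType) (T : Type) (x : T -> R) : Prop :=
  forall i, 0 <= x i <= 1.

Definition gas_feasible (R : realType) (M : market R) : set (gas_var M) :=
  [set x | [/\ unit_box (gas_x x), unit_box (gas_g2e x), unit_box (gas_g2h x) &
    \sum_o quantity o * gas_x x o =
      - (\sum_co capacity co * gas_g2e x co)
      - \sum_co capacity co * gas_g2h x co]].

Definition elec_feasible (R : realType) (M : market R) : set (elec_var M) :=
  [set x | [/\ unit_box (elec_x x), unit_box (elec_g2e x) &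
    \sum_o quantity o * elec_x x o =
      \sum_co output_capacity co * elec_g2e x co]].

Definition heat_feasible (R : realType) (M : market R) : set (heat_var M) :=
  [set x | [/\ unit_box (heat_x x), unit_box (heat_g2h x) &
    \sum_o quantity o * heat_x x o =
      \sum_co output_capacity co * heat_g2h x co]].

Definition relaxed_feasible (R : realType) (M : market R) : set (var M) :=
  [set x | [/\ gas_feasible (gas_part x), elec_feasible (elec_part x) &
    heat_feasible (heat_part x)]].

Definition order_value (R : realType) (O : orders R) (x : O -> R) : R :=
  \sum_o price o * quantity o * x o.

Definition conv_cost (R : realType) (C : conversions R) (x : C -> R) : R :=
  \sum_co conv_price co * capacity co * x co.

Definition Omega (R : realType) (M : market R) (x : var M) : R :=
  order_value (gas_x (gas_part x)) + order_value (elec_x (elec_part x))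
  + order_value (heat_x (heat_part x))
  - conv_cost (elec_g2e (elec_part x)) - conv_cost (heat_g2h (heat_part x)).

(* Problem (P) maximises [Omega] over [primal_feasible M]; the last two
   conditions are the duplication constraints, which [lagrangian] dualises. *)
Definition primal_feasible (R : realType) (M : market R) : set (var M) :=
  [set x | [/\ relaxed_feasible x,
    forall co, gas_g2e (gas_part x) co = elec_g2e (elec_part x) co &
    forall co, gas_g2h (gas_part x) co = heat_g2h (heat_part x) co]].

Definition lagrangian (R : realType) (M : market R)
    (se : g2e M -> R) (sh : g2h M -> R) (x : var M) : R :=
  Omega x
  + \sum_co se co * (gas_g2e (gas_part x) co - elec_g2e (elec_part x) co)
  + \sum_co sh co * (gas_g2h (gas_part x) co - heat_g2h (heat_part x) co).

(* The supremum is a maximum: [relaxed_feasible M] is compact and contains the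
   zero assignment, and [lagrangian se sh] is affine. *)
Definition phi (R : realType) (M : market R)
    (se : g2e M -> R) (sh : g2h M -> R) : R :=
  sup [set lagrangian se sh x | x in @relaxed_feasible R M].

Definition dual_optimal (R : realType) (M : market R)
    (se : g2e M -> R) (sh : g2h M -> R) : Prop :=
  forall (te : g2e M -> R) (th : g2h M -> R), phi se sh <= phi te th.

Definition maximizer (R : realType) (T : Type) (A : set T) (f : T -> R)
    (x : T) : Prop :=
  A x /\ forall y, A y -> f y <= f x.

Definition gas_objective (R : realType) (M : market R)
    (se : g2e M -> R) (sh : g2h M -> R) (x : gas_var M) : R :=
  order_value (gas_x x) + \sum_co se co * gas_g2e x co
  + \sum_co sh co * gas_g2h x co.

Definition elec_objective (R : realType) (M : market R)
    (se : g2e M -> R) (x : elec_var M) : R :=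
  order_value (elec_x x) - conv_cost (elec_g2e x)
  - \sum_co se co * elec_g2e x co.

Definition heat_objective (R : realType) (M : market R)
    (sh : g2h M -> R) (x : heat_var M) : R :=
  order_value (heat_x x) - conv_cost (heat_g2h x)
  - \sum_co sh co * heat_g2h x co.

(* Main.v *)
(* The updates are a subgradient method for the convex dual function [phi]:
   solutions of the three subproblems jointly maximise the Lagrangian, so the
   vector of duplication mismatches is a subgradient of [phi].  The dual has a
   minimizer: the balances allow any unprofitable conversion to be cancelled by
   curtailing orders, so clamping the multipliers to a large box does not
   increase the Lipschitz function [phi].  The squared distance of the iterates
   to any minimizer therefore decreases up to the summable error
   [#|I| * mu_k ^ 2]; as [mu] is not summable, [phi] comes arbitrarily close to
   its minimum along the bounded iterates, a cluster point of such iterates is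
   a minimizer, and quasi-monotonicity of the distance to it gives convergence
   of the whole sequence. *)
Require Import Defs.
From HB Require Import structures.
From mathcomp Require Import all_boot all_order all_algebra.
From mathcomp Require Import all_classical all_reals all_analysis.
From mathcomp Require Import ring lra.

Set Implicit Arguments.
Unset Strict Implicit.
Unset Printing Implicit Defensive.

Import Order.TTheory GRing.Theory Num.Theory.
Import numFieldNormedType.Exports.

Local Open Scope classical_set_scope.
Local Open Scope ring_scope.

(** * The subgradient method in finite dimension *)

(** By Tychonoff the box is compact in the product topology, and as [I] is finite every l1 ball
    contains a product neighbourhood. The l1 distance matches the Lipschitz hypotheses used
    later. *)
Lemma bounded_cluster (R : realType) (I : finType) (B : R)
    (u : nat -> I -> R) (u_bnd : forall k i, `|u k i| <= B) :
  exists t : I -> R, forall (e : R) (n : nat), 0 < e ->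
    exists2 k, (n <= k)%N & \sum_i `|u k i - t i| < e.
Proof.
have cptB : compact [set f : prod_topology (fun _ : I => R) |
    forall i, `[- B, B]%classic (f i)].
  by apply: (@tychonoff I (fun=> R) (fun=> `[- B, B]%classic)) => i;
    exact: segment_compact.
have [|t [_ clt]] := cptB ((u : nat -> prod_topology (fun _ : I => R)) @ \oo) _.
  by exists 0%N => // k _ i /=; rewrite in_itv /= -ler_norml.
exists t => e n e0.
have [||f [/= [k /= nk <-] lte]] :=
    clt [set u k | k in [set k | (n <= k)%N]] [set f | \sum_i `|f i - t i| < e].
- by exists n => // k /= nk; exists k.
- have d0 : 0 < e / #|I|.+1%:R by rewrite divr_gt0.
  have : \forall f \near (t : prod_topology (fun _ : I => R)),
      forall i, `|f i - t i| < e / #|I|.+1%:R.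
    apply: (filter_forall (nbhs_filter (t : prod_topology (fun _ : I => R)))) => i.
    have nti : nbhs (t i : R) [set y : R | `|y - t i| < e / #|I|.+1%:R].
      apply/nbhs_ballP; exists (e / #|I|.+1%:R) => //= y.
      by rewrite -ball_normE /= distrC.
    exact: (@proj_continuous I (fun=> R) i t _ nti).
  move=> nt; apply: (@filterS _ _ (nbhs_filter
    (t : prod_topology (fun _ : I => R))) _ _ _ nt) => f ft /=.
  apply: le_lt_trans (_ : _ <= #|I|%:R * (e / #|I|.+1%:R)) _.
    by rewrite mulr_natl -sumr_const; apply: ler_sum => i _; exact/ltW.
  by rewrite mulrCA gtr_pMr// ltr_pdivrMr// mul1r ltr_nat.
- by exists k.
Qed.

(** Expand the square of each step: the subgradient inequality bounds the cross term by
    [- 2 * c * m k], and [g_bnd] bounds the quadratic term. Taking [c = 0] gives quasi-monotone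
    distances; [c > 0] bounds the sum of the step sizes. *)
Lemma subgradient_descent (R : realType) (I : finType) (f : (I -> R) -> R)
    (m : nat -> R) (s g : nat -> I -> R)
    (m_ge0 : forall k, 0 <= m k)
    (g_bnd : forall k i, `|g k i| <= 1)
    (g_sub : forall k t, f (s k) + \sum_i g k i * (t i - s k i) <= f t)
    (s_step : forall k i, s k.+1 i = s k i - m k * g k i)
    (t : I -> R) (c : R) (p q : nat) :
  (p <= q)%N -> (forall k, (p <= k)%N -> f t + c <= f (s k)) ->
  \sum_i (s q i - t i) ^+ 2 + 2 * c * \sum_(p <= k < q) m k <=
    \sum_i (s p i - t i) ^+ 2 + #|I|%:R * \sum_(p <= k < q) m k ^+ 2.
Proof.
move=> pq fc; elim: q pq => [|q IH].
  by rewrite leqn0 => /eqP ->; rewrite !big_geq// !mulr0.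
rewrite leq_eqVlt ltnS => /predU1P[->|pq]; first by rewrite !big_geq// !mulr0.
rewrite !big_nat_recr//=.
have step : \sum_i (s q.+1 i - t i) ^+ 2 <=
    \sum_i (s q i - t i) ^+ 2 + 2 * m q * (\sum_i g q i * (t i - s q i))
    + #|I|%:R * m q ^+ 2.
  have -> : #|I|%:R * m q ^+ 2 = \sum_(i : I) m q ^+ 2.
    by rewrite sumr_const mulr_natl.
  rewrite mulr_sumr -!big_split /=; apply: ler_sum => i _; rewrite s_step.
  have gg : g q i ^+ 2 <= 1.
    by rewrite -real_normK ?num_real// expr_le1.
  have := ler_wpM2l (sqr_ge0 (m q)) gg.
  rewrite mulr1 => ?; rewrite -subr_ge0.
  have -> : (s q i - t i) ^+ 2 + 2 * m q * (g q i * (t i - s q i)) + m q ^+ 2 -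
    (s q i - m q * g q i - t i) ^+ 2 = m q ^+ 2 - m q ^+ 2 * g q i ^+ 2 by ring.
  by rewrite subr_ge0.
have sub : \sum_i g q i * (t i - s q i) <= - c.
  by have := g_sub q t; have := fc q pq; lra.
have := ler_wpM2l (m_ge0 q) sub; have := IH pq.
rewrite !mulrDr; lra.
Qed.

(* The iterates are quasi-Fejer monotone with respect to every minimizer of
   [f], in particular with respect to a cluster point of a subsequence along
   which [f] tends to its minimum. *)
Lemma subgradient_cvg (R : realType) (I : finType) (f : (I -> R) -> R)
    (m : nat -> R) (s g : nat -> I -> R) (B : R) (t0 : I -> R)
    (f_lip : forall t t', f t <= f t' + \sum_i `|t' i - t i|)
    (t0_min : forall t, f t0 <= f t)
    (m_ge0 : forall k, 0 <= m k)
    (m_sum : forall A, exists n, A < \sum_(0 <= k < n) m k)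
    (m_sum2 : forall n, \sum_(0 <= k < n) m k ^+ 2 <= B)
    (g_bnd : forall k i, `|g k i| <= 1)
    (g_sub : forall k t, f (s k) + \sum_i g k i * (t i - s k i) <= f t)
    (s_step : forall k i, s k.+1 i = s k i - m k * g k i) :
  exists2 t : I -> R, (forall t', f t <= f t') &
    forall i, s k i @[k --> \oo] --> t i.
Proof.
have descent := subgradient_descent m_ge0 g_bnd g_sub s_step.
pose N : R := #|I|%:R; have N0 : 0 <= N by rewrite ler0n.
have sum_cat (h : nat -> R) p q : (p <= q)%N ->
    \sum_(0 <= k < q) h k = \sum_(0 <= k < p) h k + \sum_(p <= k < q) h k.
  by move=> pq; rewrite (big_cat_nat (leq0n p) pq).
have sq_bnd p q : (p <= q)%N -> \sum_(p <= k < q) m k ^+ 2 <= B.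
  move=> /(sum_cat (fun k => m k ^+ 2)) E; have := m_sum2 q; rewrite E.
  apply: le_trans; rewrite lerDr; apply: sumr_ge0 => k _; exact: sqr_ge0.
(* If [f] stayed [e] above its minimum from [n] on, descent with gap [e] would bound the step sums
   over [[n, q)] by the quotient below, against [m_sum]. *)
have near_min e n : 0 < e -> exists2 k, (n <= k)%N & f (s k) < f t0 + e.
  move=> e0; apply/not_exists2P => no.
  have [q Hq] := m_sum ((\sum_i (s n i - t0 i) ^+ 2 + N * B) / (2 * e)
                        + \sum_(0 <= k < n) m k).
  have nq : (n <= q)%N.
    rewrite leqNgt; apply/negP => /ltnW qn; move: Hq; apply/negP; rewrite -leNgt.
    rewrite (sum_cat m _ _ qn) addrCA lerDl addr_ge0 ?sumr_ge0//.
    apply: divr_ge0; last by rewrite mulr_ge0// ltW.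
    rewrite addr_ge0// ?sumr_ge0// => [i _|]; first exact: sqr_ge0.
    rewrite mulr_ge0// (le_trans _ (sq_bnd n n _))// big_geq//.
  have := descent t0 e n q nq _.
  apply/not_implyP; split.
    by move=> k nk; have [//|/negP] := no k; rewrite -leNgt.
  apply/negP; rewrite -ltNge.
  move: Hq; rewrite (sum_cat m _ _ nq) addrC ltrD2l ltr_pdivrMr ?mulr_gt0//.
  move=> Hq.
  have := ler_wpM2l N0 (sq_bnd _ _ nq); rewrite -/N.
  have : 0 <= \sum_i (s q i - t0 i) ^+ 2.
    by apply: sumr_ge0 => i _; exact: sqr_ge0.
  lra.
have /choice[v Hv] : forall n, exists k,
    (n <= k)%N /\ f (s k) < f t0 + n.+1%:R^-1.
  move=> n; have [|k nk Hk] := near_min n.+1%:R^-1 n; first by rewrite invr_gt0.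
  by exists k.
(* Descent with gap 0 bounds the squared distance to [t0]; [|a| <= a ^ 2 + 1] turns this into a
   coordinate bound. *)
have s_bnd k i : `|s k i| <=
    \sum_i (s 0%N i - t0 i) ^+ 2 + N * B + 1 + \sum_i `|t0 i|.
  have D := descent t0 0 0%N k (leq0n k).
  have {}D : \sum_i (s k i - t0 i) ^+ 2 <= \sum_i (s 0%N i - t0 i) ^+ 2 + N * B.
    apply: le_trans (_ : _ <= _ + N * \sum_(0 <= j < k) m j ^+ 2) _.
      by have := D (fun j _ => _); rewrite addr0 mulr0 mul0r addr0; apply.
    by rewrite lerD2l ler_wpM2l.
  have H1 : `|t0 i| <= \sum_i `|t0 i| by rewrite (bigD1 i)//= lerDl sumr_ge0.
  have H2 : (s k i - t0 i) ^+ 2 <= \sum_i (s k i - t0 i) ^+ 2.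
    by rewrite (bigD1 i)//= lerDl sumr_ge0// => j _; exact: sqr_ge0.
  have H3 : `|s k i - t0 i| <= (s k i - t0 i) ^+ 2 + 1.
    rewrite -[in leRHS]real_normK ?num_real//.
    have := sqr_ge0 (`|s k i - t0 i| - 2^-1); nra.
  have H4 : `|s k i| <= `|s k i - t0 i| + `|t0 i|.
    by rewrite -{1}(subrK (t0 i) (s k i)) ler_normD.
  lra.
have [t Ht] := bounded_cluster (fun n => s_bnd (v n)).
have t_min t' : f t <= f t'.
  apply: le_trans (t0_min t').
  apply/ler_addgt0Pr => e e0.
  have e2 : 0 < e / 2 by rewrite divr_gt0.
  have [n0 _ Hn0] := near_infty_natSinv_lt (PosNum e2).
  have [k nk Hk] := Ht _ n0 e2.
  have /= := Hn0 k nk => k2.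
  apply: le_trans (f_lip t (s (v k))) _; rewrite [e]splitr addrA.
  by apply: lerD; [rewrite (le_trans (ltW (Hv k).2))// lerD2l|]; exact/ltW.
exists t => // i; apply/cvgrPdist_lt => e e0.
(* One half of [e ^ 2] pays for the squared distance to [t] at a good iterate, the other for the
   tail of the squared steps. *)
pose d := e ^+ 2 / 2; have d0 : 0 < d by rewrite divr_gt0// exprn_gt0.
have [n1 Hn1] : exists n1, forall q, (n1 <= q)%N ->
    N * \sum_(n1 <= k < q) m k ^+ 2 <= d.
  have d1 : 0 < d / (N + 1) by rewrite divr_gt0// ltr_wpDl.
  have hs : has_sup [set \sum_(0 <= k < n) m k ^+ 2 | n in [set: nat]].
    split; first by exists (\sum_(0 <= k < 0) m k ^+ 2), 0%N.
    by exists B => _ [n _ <-].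
  have [_ [n1 _ <-] Hn1] := sup_adherent d1 hs.
  exists n1 => q nq; have := sup_upper_bound hs (imageT _ q).
  rewrite (sum_cat (fun k => m k ^+ 2) _ _ nq) => Hq.
  have {}Hn1 : \sum_(n1 <= k < q) m k ^+ 2 <= d / (N + 1) by lra.
  apply: le_trans (ler_wpM2l N0 Hn1) _.
  by rewrite mulrCA ger_pMr// ler_pdivrMr ?ltr_wpDl// mul1r lerDl.
(* Within l1 distance 1, squares are at most absolute values, so the squared distance is below [d]
   too. *)
have min0 : 0 < Num.min 1 d by rewrite lt_min ltr01.
have [n nn] := Ht _ n1 min0; rewrite lt_min => /andP[Hn1' Hnd].
have n1v : (n1 <= v n)%N by apply: leq_trans nn _; have [] := Hv n.
near=> q.
have vq : (v n <= q)%N by near: q; exact: nbhs_infty_ge.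
have := descent t 0 (v n) q vq; rewrite mulr0 mul0r !addr0 => D.
have {}D := D (fun k _ => t_min (s k)).
have n1q : N * \sum_(v n <= k < q) m k ^+ 2 <= d.
  apply: le_trans (Hn1 q (leq_trans n1v vq)); rewrite ler_wpM2l//.
  rewrite [leRHS](big_cat_nat n1v vq)/= lerDr.
  by apply: sumr_ge0 => k _; exact: sqr_ge0.
have sq_lt : \sum_i (s (v n) i - t i) ^+ 2 < d.
  apply: le_lt_trans Hnd; apply: ler_sum => j _.
  rewrite -real_normK ?num_real// expr2 ler_piMl// ltW//.
  by apply: le_lt_trans Hn1'; rewrite (bigD1 j)//= lerDl sumr_ge0.
have : (s q i - t i) ^+ 2 < e ^+ 2.
  apply: le_lt_trans (_ : _ <= \sum_i (s q i - t i) ^+ 2) _.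
    by rewrite (bigD1 i)//= lerDl sumr_ge0// => j _; exact: sqr_ge0.
  by move: D n1q sq_lt; rewrite -/N /d; lra.
rewrite distrC -(real_normK (num_real (s q i - t i))).
by rewrite ltr_pXn2r// nnegrE ltW.
Unshelve. all: by end_near.
Qed.

(** A minimizing sequence can be moved into the box by [f_bnd]; the Lipschitz bound makes its
    cluster point a minimizer. *)
Lemma lipschitz_argmin (R : realType) (I : finType) (f : (I -> R) -> R) (a B : R)
    (f_lip : forall t t', f t <= f t' + \sum_i `|t' i - t i|)
    (f_ge : forall t, a <= f t)
    (f_bnd : forall t, exists2 t', (forall i, `|t' i| <= B) & f t' <= f t) :
  exists t, forall t', f t <= f t'.
Proof.
have hi : has_inf (range f).
  by split; [exists (f (fun=> 0)), (fun=> 0) | exists a => _ [t _ <-]].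
have /choice[u Hu] : forall n : nat, exists t,
    (forall i, `|t i| <= B) /\ f t < inf (range f) + n.+1%:R^-1.
  move=> n; have [|_ [t _ <-] Ht] := @inf_adherent _ _ n.+1%:R^-1 _ hi.
    by rewrite invr_gt0.
  by have [t' bt' ft'] := f_bnd t; exists t'; split=> //; exact: le_lt_trans Ht.
have [t Ht] := bounded_cluster (fun n => (Hu n).1).
exists t => t'.
apply: le_trans (_ : inf (range f) <= _); last first.
  by apply: ge_inf; [exact: hi.2 | exists t'].
apply/ler_addgt0Pr => e e0.
have e2 : 0 < e / 2 by rewrite divr_gt0.
have [n0 _ Hn0] := near_infty_natSinv_lt (PosNum e2).
have [k nk Hk] := Ht _ n0 e2.
have /= := Hn0 k nk => k2.
apply: le_trans (f_lip t (u k)) _; rewrite [e]splitr addrA.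
by apply: lerD; [rewrite (le_trans (ltW (Hu k).2))// lerD2l|]; exact/ltW.
Qed.

(** * Restoring a balance after cutting conversions *)

(* The outputs [y i] with [D i] are cut to [0], and the buy side ([0 < q o]) is
   scaled down to restore the balance: this costs at most [\sum_o `|p o|] per
   unit removed, which the assumption on [c] compensates. *)
Lemma curtail (R : realType) (O C : finType) (p q x : O -> R) (w c y : C -> R)
    (D : pred C) :
  (forall i, 0 <= w i) -> unit_box x -> unit_box y ->
  \sum_o q o * x o = \sum_i w i * y i ->
  (forall i, D i -> c i <= - (\sum_o `|p o|) * w i) ->
  exists x', [/\ unit_box x',
    \sum_o q o * x' o = \sum_i w i * (if D i then 0 else y i) &
    \sum_o p o * q o * x o + \sum_i c i * y i <=
    \sum_o p o * q o * x' o + \sum_i c i * (if D i then 0 else y i)].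
Proof.
move=> w0 x01 y01 bal cD.
pose P := \sum_o `|p o|.
pose b := \sum_(o | 0 < q o) q o * x o; pose r := \sum_(i | D i) w i * y i.
have x0 o : 0 <= x o by have /andP[] := x01 o.
have y0 i : 0 <= y i by have /andP[] := y01 i.
have wy0 i : 0 <= w i * y i by rewrite mulr_ge0.
have r0 : 0 <= r by apply: sumr_ge0.
have rb : r <= b.
  apply: le_trans (_ : \sum_i w i * y i <= _).
    by rewrite [leRHS](bigID D)/= lerDl sumr_ge0.
  rewrite -bal (bigID (fun o => 0 < q o))/= gerDl.
  by apply: sumr_le0 => o; rewrite -leNgt => qo; rewrite mulr_le0_ge0.
have b0 := le_trans r0 rb.
(* If [b] is 0 then so is [r], by [rb], and the default [r / 0 = 0] is the right factor. *)
pose l := r / b.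
have lb : l * b = r.
  rewrite /l; have [bE|bN] := eqVneq b 0; last by rewrite divfK.
  by rewrite bE mulr0; apply/eqP; rewrite eq_le r0 -bE rb.
have l0 : 0 <= l by rewrite divr_ge0.
have l1 : l <= 1.
  have [bE|bN] := eqVneq b 0; first by rewrite /l bE invr0 mulr0.
  by rewrite ler_pdivrMr ?mul1r// lt_neqAle eq_sym bN.
pose x' o := if 0 < q o then (1 - l) * x o else x o.
have cut (h : O -> R) : \sum_o h o * x' o =
    \sum_o h o * x o - l * \sum_(o | 0 < q o) h o * x o.
  rewrite mulr_sumr [X in _ - X]big_mkcond -sumrB; apply: eq_bigr => o _.
  by rewrite /x'; case: ifP => _; ring.
have cutD (h : C -> R) : \sum_i h i * (if D i then 0 else y i) =
    \sum_i h i * y i - \sum_(i | D i) h i * y i.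
  rewrite [X in _ - X]big_mkcond -sumrB; apply: eq_bigr => i _.
  by case: ifP => _; ring.
exists x'; split.
- move=> o; rewrite /x'; case: ifP => _ //; have /andP[? ?] := x01 o.
  by rewrite mulr_ge0 ?subr_ge0//= mulr_ile1// ?subr_ge0// gerBl.
- by rewrite cut cutD bal lb.
- rewrite (cut (fun o => p o * q o)) cutD.
  have H1 : \sum_(o | 0 < q o) p o * q o * x o <= P * b.
    rewrite mulr_sumr; apply: ler_sum => o qo; rewrite -mulrA.
    rewrite ler_wpM2r ?(mulr_ge0 (ltW qo))// (le_trans (ler_norm _))//.
    by rewrite /P (bigD1 o)//= lerDl sumr_ge0.
  have H2 : \sum_(i | D i) c i * y i <= - P * r.
    rewrite mulr_sumr; apply: ler_sum => i Di.
    by rewrite mulrA ler_wpM2r// cD.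
  have := ler_wpM2l l0 H1; rewrite mulrCA lb; lra.
Qed.

(** * The dual function and its minimizer *)

(** The slope of the Lagrangian in the multipliers. Both kinds of conversion share one sum type, so
    that the results over a single finite index set apply. *)
Definition mismatch (R : realType) (M : market R) (x : var M)
    (i : g2e M + g2h M) : R :=
  match i with
  | inl co => gas_g2e (gas_part x) co - elec_g2e (elec_part x) co
  | inr co => gas_g2h (gas_part x) co - heat_g2h (heat_part x) co
  end.

Definition dual_fun (R : realType) (M : market R) (s : g2e M + g2h M -> R) : R :=
  phi (fun co => s (inl co)) (fun co => s (inr co)).
Arguments dual_fun {R} M s.

Lemma lagrangian_mismatch (R : realType) (M : market R)
    (s : g2e M + g2h M -> R) (x : var M) :
  lagrangian (fun co => s (inl co)) (fun co => s (inr co)) x =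
  Omega x + \sum_i s i * mismatch x i.
Proof. by rewrite /lagrangian big_sumType/= addrA. Qed.

(** Separability: solutions of the three subproblems jointly maximise the Lagrangian. *)
Lemma lagrangian_split (R : realType) (M : market R)
    (se : g2e M -> R) (sh : g2h M -> R) (x : var M) :
  lagrangian se sh x = gas_objective se sh (gas_part x)
    + elec_objective se (elec_part x) + heat_objective sh (heat_part x).
Proof.
rewrite /lagrangian /Omega /gas_objective /elec_objective /heat_objective.
have E (C : finType) (t u v : C -> R) : \sum_i t i * (u i - v i) =
    \sum_i t i * u i - \sum_i t i * v i.
  by rewrite -sumrB; apply: eq_bigr => i _; rewrite mulrBr.
rewrite !E; ring.
Qed.

Lemma unit_boxB_norm (R : realType) (a b : R) :
  0 <= a <= 1 -> 0 <= b <= 1 -> `|a - b| <= 1.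
Proof. by rewrite ler_norml => /andP[? ?] /andP[? ?]; lra. Qed.

Lemma mismatch_norm (R : realType) (M : market R) (x : var M) i :
  relaxed_feasible x -> `|mismatch x i| <= 1.
Proof.
by move=> [[_ ge gh _] [_ ee _] [_ hh _]]; case: i => co; exact: unit_boxB_norm.
Qed.

Lemma sumr_mulr0 (R : realType) (I : finType) (c : I -> R) : \sum_i c i * 0 = 0.
Proof. by rewrite big1// => i _; rewrite mulr0. Qed.

Definition var0 (R : realType) (M : market R) : var M :=
  Var (GasVar (fun=> 0) (fun=> 0) (fun=> 0)) (ElecVar (fun=> 0) (fun=> 0))
      (HeatVar (fun=> 0) (fun=> 0)).

Lemma var0_feasible (R : realType) (M : market R) :
  relaxed_feasible (var0 M).
Proof.
have U (C : finType) : @unit_box R C (fun=> 0) by move=> i; rewrite lexx ler01.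
by split; split=> //=; rewrite !sumr_mulr0 ?subr0 ?oppr0.
Qed.

Lemma lagrangian_var0 (R : realType) (M : market R) se sh :
  lagrangian se sh (var0 M) = 0.
Proof.
rewrite /lagrangian /Omega /order_value /conv_cost /= !subr0 !sumr_mulr0; ring.
Qed.

Lemma unit_box_sum (R : realType) (T : finType) (c x : T -> R) :
  unit_box x -> `|\sum_i c i * x i| <= \sum_i `|c i|.
Proof.
move=> x01; apply: le_trans (ler_norm_sum _ _ _) _; apply: ler_sum => i _.
by have /andP[? ?] := x01 i; rewrite normrM ler_piMr// ger0_norm.
Qed.

(** Ensures that the [sup] in [phi] is a genuine supremum and not a default value. *)
Lemma lagrangian_has_sup (R : realType) (M : market R) se sh :
  has_sup [set lagrangian se sh x | x in @relaxed_feasible R M].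
Proof.
split.
  by exists (lagrangian se sh (var0 M)), (var0 M); first exact: var0_feasible.
have [K HK] : exists K, forall x : var M, relaxed_feasible x -> Omega x <= K.
  eexists => x [[/= g _ _ _] [/= e ee _] [/= h hh _]].
  rewrite /Omega /order_value /conv_cost.
  apply: lerB; [apply: lerB; [apply: lerD; [apply: lerD|]|]|].
  1-3: exact: le_trans (ler_norm _) (unit_box_sum _ _).
  - exact: lerNnormlW (unit_box_sum _ ee).
  - exact: lerNnormlW (unit_box_sum _ hh).
pose s (i : g2e M + g2h M) :=
  match i with inl co => se co | inr co => sh co end.
exists (K + \sum_i `|s i|) => _ [x xf <-].
rewrite (lagrangian_mismatch s) lerD ?HK//; apply: ler_sum => i _.
apply: le_trans (ler_norm _) _.
by rewrite normrM ler_piMr// mismatch_norm.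
Qed.

Lemma lagrangian_le_dual (R : realType) (M : market R) s (x : var M) :
  relaxed_feasible x ->
  Omega x + \sum_i s i * mismatch x i <= dual_fun M s.
Proof.
move=> xf; apply: (ub_le_sup (lagrangian_has_sup _ _).2).
by exists x => //; rewrite lagrangian_mismatch.
Qed.

Lemma dual_le (R : realType) (M : market R) (s : g2e M + g2h M -> R) c :
  (forall x : var M, relaxed_feasible x ->
    Omega x + \sum_i s i * mismatch x i <= c) -> dual_fun M s <= c.
Proof.
move=> H; apply: ge_sup; first exact: (lagrangian_has_sup _ _).1.
by move=> _ [x xf <-]; rewrite lagrangian_mismatch; exact: H.
Qed.

(** A supremum of affine functions whose slopes are at most 1 in each coordinate. *)
Lemma dual_lipschitz (R : realType) (M : market R) (s t : g2e M + g2h M -> R) :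
  dual_fun M s <= dual_fun M t + \sum_i `|t i - s i|.
Proof.
apply: dual_le => x xf; rewrite -lerBlDr.
apply: le_trans (lagrangian_le_dual t xf); rewrite -addrA lerD2l.
rewrite -sumrB; apply: ler_sum => i _; rewrite lerBlDr -lerBlDl -mulrBl.
apply: le_trans (ler_norm _) _; rewrite normrM distrC.
by rewrite ler_piMr// mismatch_norm.
Qed.

(* A multiplier above [B] makes conversion output worthless and one below [-B]
   makes conversion input worthless, so the corresponding acceptances can be
   cut to [0] and moving the multiplier further out cannot lower the dual. *)
Lemma dual_clamp (R : realType) (M : market R) :
  exists B, forall s : g2e M + g2h M -> R,
    exists2 t, (forall i, `|t i| <= B) & dual_fun M t <= dual_fun M s.
Proof.
pose Pg := \sum_(o : gas_orders M) `|price o|.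
pose Pe := \sum_(o : elec_orders M) `|price o|.
pose Ph := \sum_(o : heat_orders M) `|price o|.
have Pg0 : 0 <= Pg by exact: sumr_ge0.
have Pe0 : 0 <= Pe by exact: sumr_ge0.
have Ph0 : 0 <= Ph by exact: sumr_ge0.
(* [K] dominates the conversion cost plus bounds on the values of the output and of the gas input,
   so [B] exceeds both thresholds required by [curtail]. *)
pose K (C : conversions R) P (co : C) :=
  `|conv_price co * capacity co| + P * output_capacity co + Pg * capacity co.
have out0 (C : conversions R) (co : C) : 0 <= output_capacity co.
  by rewrite mulr_ge0// ltW// ?efficiency_gt0// capacity_gt0.
have cap0 (C : conversions R) (co : C) : 0 <= capacity co.
  by rewrite ltW// capacity_gt0.
have K0 (C : conversions R) P (co : C) : 0 <= P -> 0 <= K C P co.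
  by move=> P0; rewrite !addr_ge0// mulr_ge0.
pose w (i : g2e M + g2h M) : R :=
  match i with inl co => capacity co | inr co => capacity co end.
pose B := \sum_co K (g2e M) Pe co + \sum_co K (g2h M) Ph co.
have KeB co : K (g2e M) Pe co <= B.
  by rewrite /B (bigD1 co)//= -addrA lerDl addr_ge0// sumr_ge0// => *; exact: K0.
have KhB co : K (g2h M) Ph co <= B.
  rewrite /B addrC (bigD1 co)//= -addrA lerDl.
  by rewrite addr_ge0// sumr_ge0// => *; exact: K0.
have B0 : 0 <= B by rewrite addr_ge0// sumr_ge0// => *; exact: K0.
have conv_outB (C : conversions R) P (co : C) : 0 <= P -> K C P co <= B ->
    - (conv_price co * capacity co) - B <= - P * output_capacity co.
  move=> P0; rewrite /K; have := ler_norm (- (conv_price co * capacity co)).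
  by rewrite normrN; have := mulr_ge0 Pg0 (cap0 _ co); lra.
have conv_inB i : - B <= - Pg * w i.
  case: i => co /=; [have := KeB co | have := KhB co]; rewrite /K.
  - have := normr_ge0 (conv_price co * capacity co).
    by have := mulr_ge0 Pe0 (out0 _ co); lra.
  - have := normr_ge0 (conv_price co * capacity co).
    by have := mulr_ge0 Ph0 (out0 _ co); lra.
exists B => s.
pose t i := if B < s i then B else if s i < - B then - B else s i.
exists t.
  move=> i; rewrite /t; case: ltP => H1; first by rewrite ger0_norm.
  by case: ltP => H2; rewrite ler_norml; apply/andP; split; lra.
have tB i : B < s i -> t i = B by rewrite /t => ->.
have tNB i : s i < - B -> t i = - B.
  by rewrite /t => H; rewrite ltNge ifF ?H//; apply/negbF; lra.
(* A feasible point is curtailed to [x'], whose Lagrangian is no smaller at [t], and at [s] no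
   smaller than at [t]. *)
apply: dual_le => -[[xg yge ygh] [xe ye] [xh yh]].
move=> [/= [/= xg01 yge01 ygh01 balg] [/= xe01 ye01 bale] [/= xh01 yh01 balh]].
pose yg (i : g2e M + g2h M) : R :=
  match i with inl co => yge co | inr co => ygh co end.
(* Conversions consume gas, so the sell side is scaled: negating prices and quantities makes it the
   buy side and keeps their products. *)
have [||||xg' [xg'01 balg' objg]] := @curtail R (gas_orders M)
    (g2e M + g2h M)%type (fun o => - price o) (fun o => - quantity o) xg w t yg
    (fun i => s i < - B) _ xg01.
- by case=> co; exact: cap0.
- by case=> co; [exact: yge01 | exact: ygh01].
- under eq_bigr do rewrite mulNr.
  by rewrite sumrN balg big_sumType/= opprB opprK addrC.
- move=> i /tNB ->; apply: le_trans (conv_inB i) _.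
  by under eq_bigr do rewrite normrN.
have [|xe' [xe'01 bale' obje]] := @curtail R (elec_orders M)
    (g2e M) (@price R _) (@quantity R _) xe (@output_capacity R _)
    (fun co => - (conv_price co * capacity co) - t (inl co)) ye
    (fun co => B < s (inl co)) (out0 _) xe01 ye01 bale.
- by move=> co /tB ->; exact: conv_outB.
have [|xh' [xh'01 balh' objh]] := @curtail R (heat_orders M)
    (g2h M) (@price R _) (@quantity R _) xh (@output_capacity R _)
    (fun co => - (conv_price co * capacity co) - t (inr co)) yh
    (fun co => B < s (inr co)) (out0 _) xh01 yh01 balh.
- by move=> co /tB ->; exact: conv_outB.
pose yg' i := if s i < - B then 0 else yg i.
pose x' := Var (GasVar xg' (fun co => yg' (inl co)) (fun co => yg' (inr co)))
  (ElecVar xe' (fun co => if B < s (inl co) then 0 else ye co))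
  (HeatVar xh' (fun co => if B < s (inr co) then 0 else yh co)).
have if01 (b : bool) (y : R) : 0 <= y <= 1 -> 0 <= (if b then 0 else y) <= 1.
  by case: b => //; rewrite lexx ler01.
have x'f : relaxed_feasible x'.
  split; split=> //=.
  - by move=> co; exact: (if01 _ _ (yge01 co)).
  - by move=> co; exact: (if01 _ _ (ygh01 co)).
  - move: balg' => /=; under eq_bigr do rewrite mulNr.
    by rewrite sumrN big_sumType/= => /eqP; rewrite eqr_oppLR opprD => /eqP.
  - by move=> co; exact: if01.
  - by move=> co; exact: if01.
apply: le_trans (lagrangian_le_dual s x'f).
apply: le_trans (_ : Omega x' + \sum_i t i * mismatch x' i <= _); last first.
  (* Above [B] the output acceptance is 0, so the mismatch is nonnegative; below [- B] the gas
     acceptance is 0, so it is nonpositive. In both cases it has the sign of [s i - t i]. *)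
  rewrite lerD2l; apply: ler_sum => i _; rewrite -subr_ge0 -mulrBl.
  have yg01 : 0 <= yg' i by rewrite /yg'; case: i => co /=;
    [have /andP[] := if01 (s (inl co) < - B) _ (yge01 co)
    |have /andP[] := if01 (s (inr co) < - B) _ (ygh01 co)].
  have [/[dup] Bs /tB ->|sB] := ltP B (s i).
    apply: mulr_ge0; first by rewrite subr_ge0 ltW.
    by case: i Bs yg01 => co /= ->; rewrite subr0.
  have [/[dup] sNB /tNB ->|NBs] := ltP (s i) (- B).
    apply: mulr_le0; first by rewrite subr_le0 ltW.
    case: i sB sNB {yg01} => co sB sNB /=; rewrite /yg' sNB sub0r oppr_le0.
      by have /andP[] := if01 (B < s (inl co)) _ (ye01 co).
    by have /andP[] := if01 (B < s (inr co)) _ (yh01 co).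
  by rewrite /t ltNge sB /= ltNge NBs /= subrr mul0r.
have gasE x y : gas_objective (fun co => t (inl co)) (fun co => t (inr co))
    (GasVar x (fun co => y (inl co)) (fun co => y (inr co)) : gas_var M) =
    \sum_o - price o * - quantity o * x o + \sum_i t i * y i.
  rewrite big_sumType/= addrA /gas_objective /order_value /=.
  by under [X in _ = X + _ + _]eq_bigr do rewrite mulrNN.
have outE (C : conversions R) (u y : C -> R) (v : R) :
    v - conv_cost y - \sum_co u co * y co =
    v + \sum_co (- (conv_price co * capacity co) - u co) * y co.
  rewrite -addrA -opprD -big_split -sumrN; congr (_ + _).
  by apply: eq_bigr => co _ /=; ring.
rewrite -!lagrangian_mismatch !lagrangian_split.
apply: lerD; first apply: lerD.
- by move: objg; rewrite -!gasE.
- by rewrite /elec_objective !outE.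
- by rewrite /heat_objective !outE.
Qed.

Lemma dual_argmin (R : realType) (M : market R) :
  exists s, forall t, dual_fun M s <= dual_fun M t.
Proof.
have [B clamp] := dual_clamp M.
apply: (@lipschitz_argmin R (g2e M + g2h M)%type (dual_fun M) 0 B) => // [s t|s].
  exact: dual_lipschitz.
(* The zero assignment has Lagrangian value 0, whence the lower bound. *)
apply: le_trans (lagrangian_le_dual s (var0_feasible M)).
by rewrite -lagrangian_mismatch lagrangian_var0.
Qed.

(** * Convergence of the multipliers *)

Theorem proposition5 (R : realType) (M : market R) (mu : nat -> R)
    (mu_ge0 : forall k, (1 <= k)%N -> 0 <= mu k)
    (mu_cvg0 : mu k @[k --> \oo] --> (0 : R))
    (mu_sum : (\sum_(1 <= k <oo) (mu k)%:E = +oo)%E)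
    (mu_sum2 : (\sum_(1 <= k <oo) (mu k ^+ 2)%:E < +oo)%E)
    (sigma_e : nat -> g2e M -> R) (sigma_h : nat -> g2h M -> R)
    (xg : nat -> gas_var M) (xe : nat -> elec_var M) (xh : nat -> heat_var M)
    (xg_sol : forall k, (1 <= k)%N ->
      maximizer (@gas_feasible R M) (gas_objective (sigma_e k) (sigma_h k))
        (xg k))
    (xe_sol : forall k, (1 <= k)%N ->
      maximizer (@elec_feasible R M) (elec_objective (sigma_e k)) (xe k))
    (xh_sol : forall k, (1 <= k)%N ->
      maximizer (@heat_feasible R M) (heat_objective (sigma_h k)) (xh k))
    (sigma_e_step : forall k, (1 <= k)%N -> forall co,
      sigma_e k.+1 co =
        sigma_e k co - mu k * (gas_g2e (xg k) co - elec_g2e (xe k) co))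
    (sigma_h_step : forall k, (1 <= k)%N -> forall co,
      sigma_h k.+1 co =
        sigma_h k co - mu k * (gas_g2h (xg k) co - heat_g2h (xh k) co)) :
  exists (se : g2e M -> R) (sh : g2h M -> R),
    [/\ dual_optimal se sh,
        forall co, sigma_e k co @[k --> \oo] --> se co &
        forall co, sigma_h k co @[k --> \oo] --> sh co].
Proof.
(* The process starts at index 1, the abstract method at 0: everything is shifted by one. *)
pose s k (i : g2e M + g2h M) :=
  match i with inl co => sigma_e k.+1 co | inr co => sigma_h k.+1 co end.
pose x k := Var (xg k.+1) (xe k.+1) (xh k.+1).
have xf k : relaxed_feasible (x k).
  by split; [case: (xg_sol k.+1)|case: (xe_sol k.+1)|case: (xh_sol k.+1)].
have dual_s k :
    dual_fun M (s k) <= Omega (x k) + \sum_i s k i * mismatch (x k) i.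
  apply: dual_le => y [yg ye yh]; rewrite -!lagrangian_mismatch !lagrangian_split.
  apply: lerD; first apply: lerD.
  - by case: (xg_sol k.+1 isT) => _; apply.
  - by case: (xe_sol k.+1 isT) => _; apply.
  - by case: (xh_sol k.+1 isT) => _; apply.
have shift (u : nat -> R) n :
    (\sum_(1 <= k < n.+1) (u k)%:E)%E = (\sum_(0 <= k < n) u k.+1)%:E.
  by rewrite big_add1 sumEFin.
have mu2_ge0 k : (1 <= k)%N -> xpredT k -> (0 <= (mu k ^+ 2)%:E)%E.
  by rewrite lee_fin sqr_ge0.
have muE_ge0 k : (1 <= k)%N -> xpredT k -> (0 <= (mu k)%:E)%E.
  by move=> k1 _; rewrite lee_fin mu_ge0.
have [s0 s0_min] := dual_argmin M.
have [||||||||t t_min t_cvg] := @subgradient_cvg R (g2e M + g2h M)%type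
    (dual_fun M) (fun k => mu k.+1) s (fun k => mismatch (x k))
    (fine (\sum_(1 <= k <oo) (mu k ^+ 2)%:E)%E) s0.
- by move=> ? ?; exact: dual_lipschitz.
- exact: s0_min.
- by move=> k; exact: mu_ge0.
(* If all partial sums were at most [A], the series would be at most [A] and not infinite. *)
- move=> A; apply/not_existsP => no; have := mu_sum; apply/eqP.
  rewrite lt_eqF// (@le_lt_trans _ _ A%:E) ?ltry//.
  apply: lime_le; first exact: is_cvg_nneseries.
  exists 1%N => // -[//|n] _ /=; rewrite shift lee_fin leNgt; exact/negP/no.
- move=> n; rewrite -lee_fin fineK; last first.
    rewrite ge0_fin_numE//; exact: nneseries_ge0.
  have := nneseries_lim_ge n.+1 mu2_ge0.
  by rewrite (shift (fun k => mu k ^+ 2)).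
- by move=> k i; exact: mismatch_norm.
(* The point [x k] attains the dual value at [s k]; evaluating its affine Lagrangian at [t] gives
   the subgradient inequality. *)
- move=> k t; apply: le_trans (lagrangian_le_dual t (xf k)).
  apply: le_trans (lerD (dual_s k) (lexx _)) _.
  rewrite -addrA lerD2l -big_split /= le_eqVlt; apply/orP; left; apply/eqP.
  by apply: eq_bigr => i _; ring.
- by move=> k [] co; [exact: sigma_e_step | exact: sigma_h_step].
exists (fun co => t (inl co)), (fun co => t (inr co)); split.
- by move=> te th;
    exact: (t_min (fun i => match i with inl co => te co | inr co => th co end)).
- by move=> co; rewrite -cvg_shiftS; exact: (t_cvg (inl co)).
- by move=> co; rewrite -cvg_shiftS; exact: (t_cvg (inr co)).
Qed.
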